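(* Let $U$ be a subgroup of the finite group $G$, and let $N$ be a normal subgroup of $G$. Then \[ 1_{UN}^G(g)=\frac{1}{\lvert N\rvert}\sum_{n\in N}1_U^G(gn)\quad\text{for all } g\in G. \]
   Context: For a subgroup $W$ of a finite group $G$, $1_W^G$ denotes the permutation character of the action of $G$ by right multiplication on the set of right cosets $\{Wx : x\in G\}$; that is, for $g\in G$, $1_W^G(g)$ is the number of right cosets $Wx$ with $Wxg=Wx$. Since $N$ is normal in $G$, the product $UN=\{un : u\in U, n\in N\}$ is a subgroup of $G$, and $1_{UN}^G$ is the corresponding permutation character. *)

(* Defs.v *)
From mathcomp Require Import all_boot all_order all_algebra all_fingroup.
From mathcomp Require Import all_solvable all_field all_character.
Set Implicit Arguments.
Unset Strict Implicit.
Unset Printing Implicit Defensive.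
Import GroupScope GRing.Theory.
Local Open Scope ring_scope.

Fact perm_cfun_subproof (gT : finGroupType) (G : {group gT}) (W : {set gT}) :
  is_class_fun <<G>> [ffun g =>
    #|'Fix_(rcosets W G | 'Rs)[g]|%:R *+ (g \in G) : algC].
Proof.
rewrite genGid.
apply: intro_class_fun => [x y Gx Gy | x /negbTE-> //].
rewrite groupJ ?Gx //; congr (_%:R *+ _).
rewrite -(card_imset (mem 'Fix_(rcosets W G | 'Rs)[x]) (act_inj 'Rs y)).
apply: eq_card => C; apply/setIP/imsetP=> [[/rcosetsP[z Gz ->] /afix1P] | [D]].
  rewrite /= !rcosetE -!rcosetM conjgE => fixC; exists (W :* (z * y^-1)).
    rewrite inE -rcosetE imset_f ?groupM ?groupV //=; apply/afix1P.
    rewrite /= !rcosetE -rcosetM; apply: (can_inj (rcosetK y)).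
    by rewrite -!rcosetM mulgKV -mulgA -fixC !mulgA.
  by rewrite /= rcosetE -rcosetM mulgKV.
case/setIP=> /rcosetsP[z Gz ->] /afix1P /=; rewrite !rcosetE -!rcosetM => fixD.
move=> ->; split; first by rewrite -rcosetE imset_f ?groupM.
apply/afix1P; rewrite /= !rcosetE -!rcosetM -mulgA -conjgC mulgA.
by rewrite (rcosetM W (z * x)%g) fixD -rcosetM.
Qed.

(* The permutation character 1_W^G for the action of G by right multiplication
   on the right cosets of W: its value at g \in G is the number of fixed
   cosets W :* x with (W :* x) :* g = W :* x. As a class function on G it is
   extended by 0 outside G. It is meant for W a subgroup of G; W is a bare set
   only so that it can be the product set of two subgroups. *)
Definition perm_cfun (gT : finGroupType) (G : {group gT}) (W : {set gT})
  : 'CF(G) := Cfun 0 (perm_cfun_subproof G W).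

Lemma perm_cfunE (gT : finGroupType) (G : {group gT}) (W : {set gT}) g :
  g \in G -> perm_cfun G W g = #|[set C in rcosets W G | C :* g == C]|%:R.
Proof.
move=> Gg; rewrite cfunE Gg mulr1n; congr _%:R; apply: eq_card => C.
by rewrite !inE sub1set inE /= rcosetE.
Qed.

(* Main.v *)
(* Both sides count conjugators: for a subgroup W the number of fixed cosets is
   #|{x in G : x g x^-1 \in W}| / #|W|. Summing over gN, each x contributes the
   number of n in N with (x g x^-1) n in U, i.e. the size of the intersection
   of U with a coset of N, which is #|U :&: N| or 0 according to whether
   x g x^-1 lies in U N; then #|U N| #|U :&: N| = #|U| #|N|. *)
Require Import Defs.
From mathcomp Require Import all_boot all_order all_algebra all_fingroup.
From mathcomp Require Import all_solvable all_field all_character.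
Import GroupScope GRing.Theory.
Local Open Scope ring_scope.

Lemma rcoset_fixE (gT : finGroupType) (W : {group gT}) (x g : gT) :
  (W :* x :* g == W :* x)%g = (g ^ x^-1 \in W)%g.
Proof.
rewrite -rcosetM eq_sym; apply/eqP/idP => [eqW | Wgx].
  by have := rcoset_refl W (x * g)%g; rewrite -eqW mem_rcoset conjgE invgK mulgA.
by apply: rcoset_eqP; rewrite rcoset_sym mem_rcoset -mulgA -{1}[x]invgK -conjgE.
Qed.

(** Whether [g ^ x^-1] lies in [W] depends only on the coset [W :* x], so the set of such [x] is
    partitioned by the fixed cosets, each of size [#|W|]. *)
Lemma card_rcosets_fix (gT : finGroupType) (G W : {group gT}) (g : gT) :
  W \subset G ->
  (#|[set C in rcosets W G | C :* g == C]| * #|W|)%N =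
    #|[set x in G | (g ^ x^-1)%g \in W]|.
Proof.
move=> sWG; set P := [set C in _ | _].
have sP : P \subset rcosets W G by apply/subsetP=> C; rewrite inE => /andP[].
have /and3P[_ tiR nR] := rcosets_partition sWG.
apply/esym/card_uniform_partition => [C /(subsetP sP)/rcosetsP[x _ ->]|].
  exact: card_rcoset.
apply/and3P; split; last first.
- by apply: contra nR; apply: (subsetP sP).
- exact: trivIsetS sP tiR.
apply/eqP/setP=> x; rewrite inE; apply/bigcupP/andP=> [[C] | [Gx Wgx]].
  rewrite inE => /andP[/rcosetsP[y Gy ->] fixC] Cx.
  rewrite -rcoset_fixE (rcoset_eqP Cx); split=> //.
  by have := subsetP (mul_subG sWG _) _ Cx; apply; rewrite sub1set.
by exists (W :* x)%g; rewrite ?rcoset_refl // inE rcoset_fixE Wgx -rcosetE imset_f.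
Qed.

Lemma perm_cfun_conj (gT : finGroupType) (G W : {group gT}) (g : gT) :
  W \subset G -> g \in G ->
  perm_cfun G W g * #|W|%:R = \sum_(x in G) ((g ^ x^-1)%g \in W)%:R.
Proof.
move=> sWG Gg; rewrite perm_cfunE // -natrM card_rcosets_fix // -natr_sum.
by rewrite -sum1dep_card big_mkcondr.
Qed.

Lemma card_mulg_mem (gT : finGroupType) (U N : {group gT}) (h : gT) :
  (\sum_(n in N) (h * n \in U)%g)%N = (#|U :&: N| * (h \in U * N)%g)%N.
Proof.
have -> : (\sum_(n in N) (h * n \in U)%g)%N =
    #|[set n in N | (h * n)%g \in U]|.
  by rewrite -sum1dep_card big_mkcondr.
have [/mulsgP[u n Uu Nn ->] | notUN] := boolP (h \in (U * N)%g); last first.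
  rewrite muln0; apply: eq_card0 => n; rewrite inE; apply: contraNF notUN.
  case/andP=> Nn Uhn; apply/mulsgP; exists (h * n)%g n^-1%g; rewrite ?groupV //.
  by rewrite mulgK.
(* With [h = u * n], an [m] is counted iff [n * m] lies in [U :&: N], so the solutions form the left
   coset of [U :&: N] by [n^-1]. *)
rewrite muln1 -(card_lcoset (U :&: N) n^-1); apply: eq_card => m.
rewrite mem_lcoset invgK inE in_setI -mulgA.
by rewrite !(groupMl _ Uu, groupMl _ Nn) andbC.
Qed.

Theorem lemma2 (gT : finGroupType) (G U N : {group gT})
    (sUG : U \subset G) (nNG : N <| G) :
  forall g : gT, g \in G ->
    perm_cfun G (U * N)%g g =
      (#|N|%:R)^-1 * \sum_(n in N) perm_cfun G U (g * n)%g.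
Proof.
move=> g Gg; have [sNG nGN] := andP nNG.
(* [U] normalises [N], so the product set is a group, as [perm_cfun_conj] requires. *)
have defUN : (U * N)%g = (U <*> N)%G by rewrite /= norm_joinEl ?(subset_trans sUG).
have sUNG : (U <*> N)%G \subset G by rewrite join_subG sUG.
have nz (H : {group gT}) : #|H|%:R != 0 :> algC by rewrite neq0CG.
apply: (mulfI (nz N)); rewrite mulVKf //; apply: (mulIf (nz U)).
(* Trading [#|U| * #|N|] for [#|U * N| * #|U :&: N|] lets [perm_cfun_conj] absorb the first factor
   and [card_mulg_mem] the second. *)
rewrite mulrAC -natrM mulnC mul_cardG natrM mulrC mulrA defUN perm_cfun_conj //.
rewrite mulrC.
transitivity (\sum_(n in N) \sum_(x in G)
    ((((g * n) ^ x^-1)%g \in U)%:R : algC)); last first.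
  rewrite mulr_suml; apply: eq_bigr => n Nn.
  by rewrite perm_cfun_conj // groupM // (subsetP sNG).
rewrite exchange_big mulr_sumr; apply: eq_bigr => x Gx.
rewrite -defUN -natrM -card_mulg_mem natr_sum.
(* By normality, conjugation by [x^-1] permutes [N]; it turns [g ^ x^-1 * n] into
   [(g * n) ^ x^-1]. *)
rewrite (reindex_inj (conjg_inj x^-1%g)); apply: eq_big => n.
  by rewrite memJ_norm // groupV (subsetP nGN).
by rewrite conjMg.
Qed.
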